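(* Assume periodic boundary conditions, constant $\varepsilon,\mu>0$, and a fixed staggered spatial grid. Let $U_h(t)$ denote the solution of the resulting semidiscrete Maxwell system, and let $U_h^n$, $n\ge 0$, with $U_h^0=U_h(0)$, be generated with time step $\Delta t$ by either $\Phi_{\rm stab}$ or $\Phi_{\rm disp}$, i.e. $U_h^{n+1}=\Phi U_h^n$. Suppose that all nonzero Fourier modes of the grid satisfy $$0\le q\le q_0<q_*,\qquad q_*=4\ \text{for }\Phi_{\rm stab},\qquad q_*=\sqrt{12}\ \text{for }\Phi_{\rm disp}.$$ Then for every fixed final time $T>0$ there exists a constant $C_{h,T,q_0}$, independent of $\Delta t$, such that $$\max_{0\le n\Delta t\le T}\left\|U_h^n-U_h(t_n)\right\|_h\le C_{h,T,q_0}\,\Delta t^2\,\|U_h(0)\|_h,\qquad t_n=n\Delta t .$$ For $\Phi_{\rm disp}$, $\|\cdot\|_h$ denotes the complex discrete $\ell^2$ norm.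
   Context: Continuous system. With $\nu=(\varepsilon\mu)^{-1/2}$, $\bm h=\sqrt\mu\,\bm H$, $\bm e=\sqrt\varepsilon\,\bm E$, the source-free Maxwell equations in energy-scaled variables are $\partial_t\bm h=-\nu\nabla\times\bm e$, $\partial_t\bm e=\nu\nabla\times\bm h$. Spatial discretization. The fields depend on $d\in\{1,2,3\}$ active coordinates and are sampled on a periodic uniform Yee-type staggered grid with equal mesh width $\Delta x$ in the active directions ($e_i$ is located at half-integer points in direction $i$ and integer points in the other directions; $h_i$ at integer points in direction $i$ and half-integer points in the other directions). Each partial derivative in an active direction is replaced by the fourth-order centered staggered difference $\frac{27(u_{i+1/2}-u_{i-1/2})-(u_{i+3/2}-u_{i-3/2})}{24\Delta x}$ (derivatives in inactive directions are zero). Replacing both curls by the resulting discrete curls gives the finite-dimensional semidiscrete Maxwell system $\frac{d}{dt}U_h=(\mathcal C_h+\mathcal D_h)U_h$ for $U_h=(\bm h,\bm e)$, where $$\mathcal C_h=\nu\begin{bmatrix}0&0\\ \nabla_h\times&0\end{bmatrix},\qquad \mathcal D_h=\nu\begin{bmatrix}0&-\nabla_h\times\\0&0\end{bmatrix}.$$ The norm $\|\cdot\|_h$ is the discrete $\ell^2$ norm of $U_h$ (square root of $\Delta x^d$ times the sum of squared moduli of all components). Time stepping. For $a\in\mathbb{C}$, $$\Phi_{\Delta t}(a)=e^{a\Delta t\mathcal C_h}e^{\frac12\Delta t\mathcal D_h}e^{(1-2a)\Delta t\mathcal C_h}e^{\frac12\Delta t\mathcal D_h}e^{a\Delta t\mathcal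 C_h},$$ where $e^{\tau\mathcal C_h}=I+\tau\mathcal C_h$ and $e^{\tau\mathcal D_h}=I+\tau\mathcal D_h$. $\Phi_{\rm stab}=\Phi_{\Delta t}(1/4)$ and $\Phi_{\rm disp}=\Phi_{\Delta t}(a_\pm)$ with $a_\pm=\frac14\pm\frac{\mathrm i}{4\sqrt3}$ (either fixed sign). Fourier modes. For a discrete wave vector $\kappa$ of the grid, $\eta_\xi=\frac{27\sin(\kappa_\xi\Delta x/2)-\sin(3\kappa_\xi\Delta x/2)}{12}$, $K_h^2=\frac1{\Delta x^2}\sum_{\xi=1}^d\eta_\xi^2$, and $q=\nu\Delta tK_h$. The constant $C_{h,T,q_0}$ may depend on the fixed grid, on $T$ and $q_0$ (and on the fixed $\nu$ and the chosen method), but not on $\Delta t$ (as long as the mode condition holds) nor on the initial data. *)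

(* Defs.v *)
From HB Require Import structures.
From mathcomp Require Import all_boot all_order all_algebra.
From mathcomp Require Import all_classical all_reals all_analysis.
From mathcomp Require Import complex.

Set Implicit Arguments.
Unset Strict Implicit.
Unset Printing Implicit Defensive.

Import Order.TTheory GRing.Theory Num.Theory.
Import numFieldNormedType.Exports.

Local Open Scope classical_set_scope.
Local Open Scope ring_scope.
Local Open Scope complex_scope.

(* A grid is given by the set A of active directions, the number N xi of mesh
   cells in each active direction xi, and the common mesh width dx.  Inactive
   directions carry a single cell. *)
Definition extent (A : {set 'I_3}) (N : 'I_3 -> nat) (xi : 'I_3) : nat :=
  if xi \in A then N xi else 1%N.

Definition cell (A : {set 'I_3}) (N : 'I_3 -> nat) : Type :=
  {dffun forall xi : 'I_3, 'I_(extent A N xi)}.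

(* A component staggered by s_xi in {0, 1/2} in direction xi stores at the
   multi-index j its value at the point (j_xi + s_xi) dx; j is periodic. *)
Definition cell_succ A N (xi : 'I_3) (j : cell A N) : cell A N :=
  [ffun eta => if eta == xi then ordS (j eta) else j eta].

Definition cell_pred A N (xi : 'I_3) (j : cell A N) : cell A N :=
  [ffun eta => if eta == xi then ord_pred (j eta) else j eta].

(* e_half i xi: is e_i at half-integer points in direction xi? *)
Definition e_half (i xi : 'I_3) : bool := xi == i.
Definition h_half (i xi : 'I_3) : bool := xi != i.

Section Semidiscrete.

Variables (R : realType) (A : {set 'I_3}) (N : 'I_3 -> nat) (dx nu : R).

(* The fields are complex-valued, since the time step may be complex. *)
Definition vfield : Type := {ffun 'I_3 * cell A N -> R[i]}.

(* First component h, second component e. *)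
Definition state : Type := (vfield * vfield)%type.

(* Fourth-order staggered difference in direction xi of a function u located at
   integer (half = false) or half-integer (half = true) points.  The result
   lives at the points of the other kind: entry j is the difference centred at
   j + 1/2, respectively at j. *)
Definition ddiff (half : bool) (xi : 'I_3) (u : cell A N -> R[i])
    (j : cell A N) : R[i] :=
  if xi \in A then
    (if half then
       27%:R * (u j - u (cell_pred xi j))
         - (u (cell_succ xi j) - u (cell_pred xi (cell_pred xi j)))
     else
       27%:R * (u (cell_succ xi j) - u j)
         - (u (cell_succ xi (cell_succ xi j)) - u (cell_pred xi j)))
    / (24%:R * dx%:C)
  else 0.

(* (curl u)_i = d_{i+1} u_{i+2} - d_{i+2} u_{i+1}, indices modulo 3 *)
Definition curl (half : 'I_3 -> 'I_3 -> bool) (u : vfield) : vfield :=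
  [ffun p : 'I_3 * cell A N =>
    let i := p.1 in
    let y := ordS i in
    let z := ord_pred i in
    ddiff (half z y) y (fun j => u (z, j)) p.2
      - ddiff (half y z) z (fun j => u (y, j)) p.2].

Definition Ch (U : state) : state := (0, nu%:C *: curl h_half U.1).
Definition Dh (U : state) : state := (- (nu%:C *: curl e_half U.2), 0).

(* Ch and Dh square to zero (Ch_nilp, Dh_nilp), so that the exponential series
   of tau Ch and tau Dh stop after the linear term. *)
Definition expCh (tau : R[i]) (U : state) : state := U + tau *: Ch U.
Definition expDh (tau : R[i]) (U : state) : state := U + tau *: Dh U.

Definition Phi (a : R[i]) (dt : R) (U : state) : state :=
  expCh (a * dt%:C)
    (expDh (2%:R^-1 * dt%:C)
      (expCh ((1 - 2%:R * a) * dt%:C)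
        (expDh (2%:R^-1 * dt%:C)
          (expCh (a * dt%:C) U)))).

Definition norm_h (U : state) : R :=
  Num.sqrt (dx ^+ #|A| *
    (\sum_p ComplexField.Normc.normc (U.1 p) ^+ 2
     + \sum_p ComplexField.Normc.normc (U.2 p) ^+ 2)).

Definition field_derive (u : R -> vfield) (t : R) (v : vfield) : Prop :=
  forall p, is_derive t (1 : R) (fun s => complex.Re (u s p)) (complex.Re (v p))
         /\ is_derive t (1 : R) (fun s => complex.Im (u s p)) (complex.Im (v p)).

Definition field_rcont (u : R -> vfield) (t : R) : Prop :=
  forall p, complex.Re (u s p) @[s --> t^'+] --> complex.Re (u t p)
         /\ complex.Im (u s p) @[s --> t^'+] --> complex.Im (u t p).

(* U solves U' = (Ch + Dh) U on [0, +oo[, with initial value U 0. *)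
Definition semidiscrete_solution (U : R -> state) : Prop :=
  [/\ field_rcont (fun s => (U s).1) 0,
      field_rcont (fun s => (U s).2) 0 &
      forall t : R, 0 < t ->
        field_derive (fun s => (U s).1) t (Ch (U t) + Dh (U t)).1 /\
        field_derive (fun s => (U s).2) t (Ch (U t) + Dh (U t)).2].

(* Discrete wave vectors are kappa_xi = 2 pi m_xi / (N_xi dx), 0 <= m_xi < N_xi.
   Other representatives modulo 2 pi / dx give the same eta_xi ^+ 2. *)
Definition wave (m : cell A N) (xi : 'I_3) : R :=
  2%:R * pi * (m xi)%:R / ((extent A N xi)%:R * dx).

Definition wave_eta (kappa : 'I_3 -> R) (xi : 'I_3) : R :=
  (27%:R * sin (kappa xi * dx / 2%:R) - sin (3%:R * kappa xi * dx / 2%:R))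
  / 12%:R.

Definition wave_K (kappa : 'I_3 -> R) : R :=
  Num.sqrt ((dx ^+ 2)^-1 * \sum_(xi in A) wave_eta kappa xi ^+ 2).

Definition wave_q (dt : R) (kappa : 'I_3 -> R) : R := nu * dt * wave_K kappa.

Definition modes_bounded (dt q0 : R) : Prop :=
  forall m : cell A N, (exists xi, wave m xi != 0) ->
    0 <= wave_q dt (wave m) <= q0.

Lemma ddiff0 (half : bool) (xi : 'I_3) (u : cell A N -> R[i]) (j : cell A N) :
  (forall k, u k = 0) -> ddiff half xi u j = 0.
Proof.
by move=> u0; rewrite /ddiff !u0 subrr mulr0 subrr if_same mul0r if_same.
Qed.

Lemma curl0 (half : 'I_3 -> 'I_3 -> bool) : curl half 0 = 0.
Proof.
apply/ffunP => p; rewrite !ffunE /=.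
by rewrite !ddiff0 ?subrr // => k; rewrite ffunE.
Qed.

Lemma Ch_nilp (U : state) : Ch (Ch U) = 0.
Proof. by rewrite /Ch /= curl0 scaler0. Qed.

Lemma Dh_nilp (U : state) : Dh (Dh U) = 0.
Proof. by rewrite /Dh /= curl0 scaler0 oppr0. Qed.

End Semidiscrete.

Inductive splitting : Type :=
  | Stab
  | DispPlus
  | DispMinus.

Definition splitting_coef (R : realType) (s : splitting) : R[i] :=
  match s with
  | Stab => (4%:R^-1 : R) +i* 0
  | DispPlus => (4%:R^-1 : R) +i* (4%:R * Num.sqrt 3%:R)^-1
  | DispMinus => (4%:R^-1 : R) -i* (4%:R * Num.sqrt 3%:R)^-1
  end.

Definition q_star (R : realType) (s : splitting) : R :=
  match s with
  | Stab => 4%:R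
  | DispPlus | DispMinus => Num.sqrt 12%:R
  end.

(* Main.v *)
Require Import Defs.
From HB Require Import structures.
From mathcomp Require Import all_boot all_order all_algebra.
From mathcomp Require Import all_classical all_reals all_analysis.
From mathcomp Require Import complex ring lra.

(* On a fixed grid the semidiscrete system U' = L U, with L = Ch + Dh, is a
   linear ODE with a bounded generator.  Expanding the five substeps, and using
   that Ch and Dh square to zero, gives
   Phi = 1 + dt L + dt^2/2 L^2 + O(dt^3) for every coefficient a, and
   |Phi| <= exp(l dt) because each substep 1 + z dt F satisfies such a bound.
   The exact solution stays bounded on [0, T] by Gronwall's inequality and, by
   three applications of the mean value theorem, has the same expansion up to
   O(dt^3).  Since n dt <= T, summing the local errors gives O(dt^2).  All
   estimates are made in the l^1 norm of the real coordinates, which is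
   equivalent to the discrete l^2 norm. *)

Set Implicit Arguments.
Unset Strict Implicit.
Unset Printing Implicit Defensive.

Import Order.TTheory GRing.Theory Num.Theory.
Import numFieldNormedType.Exports.
Local Open Scope ring_scope.

(** * Finite families of real functions: norm comparison, mean value theorem, Gronwall *)

Section FiniteSystem.
Variables (R : realType) (I : finType).

Lemma sumr_norm_le_card (x : I -> R) (M : R) :
  (forall i, `|x i| <= M) -> \sum_i `|x i| <= #|I|%:R * M.
Proof.
move=> xM; rewrite mulr_natl -sumr_const; exact: ler_sum.
Qed.

Lemma norm_le_sumr_norm (x : I -> R) (i : I) : `|x i| <= \sum_j `|x j|.
Proof. by rewrite (bigD1 i) //= lerDl sumr_ge0. Qed.

Lemma sumr_sqr_le (x : I -> R) : \sum_i x i ^+ 2 <= (\sum_i `|x i|) ^+ 2.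
Proof.
rewrite expr2 mulr_suml; apply: ler_sum => i _.
rewrite -real_normK ?num_real // expr2 ler_wpM2l //; exact: norm_le_sumr_norm.
Qed.

Lemma sumr_norm_le_sqrt (x : I -> R) :
  \sum_i `|x i| <= #|I|%:R * Num.sqrt (\sum_i x i ^+ 2).
Proof.
apply: sumr_norm_le_card => i; rewrite -sqrtr_sqr ler_sqrt; last first.
  by apply: sumr_ge0 => j _; exact: sqr_ge0.
by rewrite (bigD1 i) //= lerDl sumr_ge0 // => j _; exact: sqr_ge0.
Qed.

Lemma is_derive_bigsum (f : I -> R -> R) (g : I -> R) (t : R) :
  (forall i, is_derive t 1 (f i) (g i)) ->
  is_derive t 1 (fun s => \sum_i f i s) (\sum_i g i).
Proof.
move=> fg; elim: (index_enum I) => [|i r IH].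
  rewrite big_nil (_ : (fun _ => _) = cst 0); first exact: is_derive_cst.
  by apply/funext => s; rewrite big_nil.
rewrite big_cons (_ : (fun _ => _) = f i \+ (fun s => \sum_(j <- r) f j s)).
  exact: is_deriveD.
by apply/funext => s; rewrite big_cons.
Qed.

(** A solution is differentiable only for positive times and right-continuous at 0. This supplies
    the continuity on closed intervals, possibly starting at 0, that the mean value and monotonicity
    theorems require. *)
Lemma continuous_within_half_line (f : R -> R) (a b : R) : 0 <= a -> a < b ->
  (f x @[x --> 0^'+] --> f 0)%classic ->
  (forall t : R, 0 < t -> derivable f t 1) ->
  {within `[a, b], continuous f}%classic.
Proof.
move=> a0 ab f0 df; have cf (t : R) : 0 < t -> {for t, continuous f}.
  by move=> t0; apply/differentiable_continuous/derivable1_diffP/df.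
apply/(continuous_within_itvP _ ab); split.
- move=> x; rewrite in_itv /= => /andP[ax _]; apply: cf; exact: le_lt_trans ax.
- move: a0; rewrite le_eqVlt => /orP[/eqP <- //|/cf ca].
  exact: cvg_at_right_filter.
- apply: cvg_at_left_filter; apply: cf; exact: le_lt_trans ab.
Qed.

(** The intermediate point depends on the coordinate, so each coordinate is bounded separately by
    the bound [M] on the whole sum; this costs the factor [#|I|]. *)
Lemma sumr_mean_value (f g : I -> R -> R) (a b M : R) : a < b ->
  (forall i, {within `[a, b], continuous (f i)}%classic) ->
  (forall i (s : R), a < s < b -> is_derive s 1 (f i) (g i s)) ->
  (forall s : R, a < s < b -> \sum_i `|g i s| <= M) ->
  \sum_i `|f i b - f i a| <= #|I|%:R * M * (b - a).
Proof.
move=> ab cf fg gM; rewrite -mulrA; apply: sumr_norm_le_card => i.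
have dfi (s : R) : s \in `]a, b[ -> is_derive s 1 (f i) (g i s).
  by rewrite in_itv; exact: fg.
have [c cab ->] := MVT ab dfi (cf i).
rewrite normrM (ger0_norm (_ : 0 <= b - a)) ?subr_ge0 ?(ltW ab) //.
rewrite ler_wpM2r ?subr_ge0 ?(ltW ab) //; move: cab; rewrite in_itv /= => /gM.
by apply: le_trans; exact: (norm_le_sumr_norm (fun j => g j c)).
Qed.

(** The sum of squares [S] is used because, unlike the l^1 norm, it is differentiable. Its
    derivative is twice the sum of [f i * g i], at most [2 * k] times the squared l^1 norm of [f],
    hence at most [c * S] with [c = 2 * k * #|I|^2]. So [expR (- c * s) * S s] is nonincreasing. *)
Lemma gronwall_sumr_sqr (f g : I -> R -> R) (k : R) : 0 <= k ->
  (forall i, f i x @[x --> 0^'+] --> f i 0)%classic ->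
  (forall i (t : R), 0 < t -> is_derive t 1 (f i) (g i t)) ->
  (forall t : R, 0 < t -> \sum_i `|g i t| <= k * \sum_i `|f i t|) ->
  forall t : R, 0 <= t -> \sum_i f i t ^+ 2 <=
    expR (2 * k * #|I|%:R ^+ 2 * t) * \sum_i f i 0 ^+ 2.
Proof.
move=> k0 f0 fg gk t; rewrite le_eqVlt => /orP[/eqP <-|t0].
  by rewrite mulr0 expR0 mul1r.
set c := 2 * k * _.
pose S (s : R) := \sum_i f i s ^+ 2.
pose F (s : R) := expR (- c * s) * S s.
have dS (s : R) : 0 < s -> is_derive s 1 S (\sum_i 2 * (f i s * g i s)).
  move=> s0; apply: is_derive_bigsum => i.
  have := is_deriveX 2 (fg i s s0); rewrite /= expr1.
  rewrite -[_ *: _]/(_ * _ * _) mulrA.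
  exact.
have dE (s : R) : is_derive s 1 (fun s => expR (- c * s)) (expR (- c * s) * - c).
  have H : is_derive s 1 (fun s : R => - c * s) (- c).
    have := is_deriveZ (- c) (is_derive_id s (1 : R)).
    by rewrite -[_ *: 1]/(_ * 1) mulr1.
  exact: (is_derive1_comp (is_derive_expR _) H).
have dF (s : R) : 0 < s ->
    is_derive s 1 F (expR (- c * s) * (\sum_i 2 * (f i s * g i s) - c * S s)).
  move=> s0; have := is_deriveM (dE s) (dS s s0).
  rewrite -![_ *: _]/(_ * _).
  by rewrite [X in is_derive _ _ _ X](_ : _ =
    (expR (- c * s) * (\sum_i 2 * (f i s * g i s) - c * S s))) //; ring.
have dF0 (s : R) : 0 < s -> F^`()%classic s <= 0.
  move=> s0; have [_ F's] := dF s s0; rewrite derive1E F's.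
  rewrite pmulr_rle0 ?expR_gt0 // subr_le0 -mulr_sumr.
  have S0 : 0 <= S s by apply: sumr_ge0 => i _; exact: sqr_ge0.
  have h1 : \sum_i f i s * g i s <= k * (\sum_i `|f i s|) ^+ 2.
    apply: (@le_trans _ _ ((\sum_i `|f i s|) * \sum_i `|g i s|)); last first.
      by rewrite expr2 mulrCA ler_wpM2l ?gk // sumr_ge0.
    rewrite mulr_suml; apply: ler_sum => i _.
    apply: le_trans (ler_norm _) _; rewrite normrM ler_wpM2l //.
    exact: (norm_le_sumr_norm (fun j => g j s)).
  have h2 : (\sum_i `|f i s|) ^+ 2 <= #|I|%:R ^+ 2 * S s.
    rewrite -[X in _ * X](sqr_sqrtr S0) -exprMn ler_pXn2r ?nnegrE ?sumr_ge0 //.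
    exact: sumr_norm_le_sqrt.
  rewrite /c -!mulrA ler_wpM2l //; apply: le_trans h1 _.
  by rewrite ler_wpM2l // mulrA.
have cE : {for 0, continuous (fun s : R => expR (- c * s))}%classic.
  by apply/differentiable_continuous/derivable1_diffP; case: (dE 0).
have S0 : (S x @[x --> 0^'+] --> S 0)%classic.
  rewrite /S; elim: (index_enum I) => [|i r IH].
    by under eq_fun do rewrite big_nil; rewrite big_nil; exact: cvg_cst.
  under eq_fun do rewrite big_cons; rewrite big_cons.
  by apply: cvgD => //; apply: cvgM; exact: f0.
have F0 : (F x @[x --> 0^'+] --> F 0)%classic.
  by apply: cvgM => //; exact: cvg_at_right_filter.
have dF' (s : R) : 0 < s -> derivable F s 1 by move=> s0; case: (dF s s0).
have cF := continuous_within_half_line (lexx 0) t0 F0 dF'.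
have dFi (s : R) : s \in `]0, t[ -> derivable F s 1.
  by rewrite in_itv /= => /andP[/dF'].
have dF0i (s : R) : s \in `]0, t[ -> F^`()%classic s <= 0.
  by rewrite in_itv /= => /andP[/dF0].
have t_itv : t \in `[0, t] by rewrite in_itv /= lexx ltW.
have zero_itv : 0 \in `[0, t] by rewrite in_itv /= lexx ltW.
have := ler0_derive1_le_cc dFi dF0i cF t_itv zero_itv (ltW t0).
rewrite /F mulr0 expR0 mul1r mulNr expRN => Ft.
by rewrite -ler_pdivrMl ?expR_gt0.
Qed.

End FiniteSystem.

(* The separating linear functionals [f] turn the identity into one between
   scalars. *)
Lemma splitting_expansion (K : numFieldType) (V : lmodType K) (I : Type)
    (f : I -> V -> K) (C D : {linear V -> V}) (a t : K) :
  (forall i x y, f i (x + y) = f i x + f i y) ->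
  (forall i s x, f i (s *: x) = s * f i x) ->
  (forall x y, (forall i, f i x = f i y) -> x = y) ->
  (forall x, C (C x) = 0) -> (forall x, D (D x) = 0) ->
  let eC s x := x + s *: C x in
  let eD s x := x + s *: D x in
  let L x := C x + D x in
  forall x,
  eC (a * t) (eD (2^-1 * t) (eC ((1 - 2 * a) * t) (eD (2^-1 * t) (eC (a * t) x))))
  = x + t *: L x + (t ^+ 2 / 2) *: L (L x) + t ^+ 3 *:
      ((a * (1 - 2 * a) + a ^+ 2) *: C (D (C x)) + ((1 - 2 * a) / 4) *: D (C (D x))
       + t *: ((a * (1 - 2 * a) / 4) *: (C (D (C (D x))) + D (C (D (C x)))))
       + t ^+ 2 *: ((a ^+ 2 * (1 - 2 * a) / 4) *: C (D (C (D (C x)))))).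
Proof.
move=> fD fZ f_inj CC DD eC eD L x; rewrite /eC /eD /L.
have CD y z : C (y + z) = C y + C z by rewrite raddfD.
have DDD y z : D (y + z) = D y + D z by rewrite raddfD.
have [C0 D0] : C 0 = 0 /\ D 0 = 0 by rewrite !raddf0.
have CZ s y : C (s *: y) = s *: C y by rewrite linearZ.
have DZ s y : D (s *: y) = s *: D y by rewrite linearZ.
(* Once everything is distributed, only the alternating words in [C] and [D] survive; it remains to
   compare their coefficients. *)
rewrite !(CD, DDD, CZ, DZ, CC, DD, C0, D0, scaler0, addr0, add0r).
by apply: f_inj => i; rewrite !(fD, fZ); field.
Qed.

(** * Real coordinates, the l^1 norm and linearity of the operators *)

Section StateSpace.
Local Open Scope complex_scope.
Variables (R : realType) (A : {set 'I_3}) (N : 'I_3 -> nat) (dx nu : R).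
Local Notation V := (state R A N).

(** The first Boolean selects [h] (true) or [e] (false), the second the real (true) or imaginary
    (false) part. A complex state thus becomes a finite family of real functions of time, to which
    real calculus applies. *)
Definition state_coord (i : bool * bool * ('I_3 * cell A N)) (U : V) : R :=
  let z := (if i.1.1 then U.1 else U.2) i.2 in
  if i.1.2 then complex.Re z else complex.Im z.

Lemma state_coordD i (U W : V) :
  state_coord i (U + W) = state_coord i U + state_coord i W.
Proof.
case: i => [[b c] p]; rewrite /state_coord /=.
by case: b; case: c; rewrite !ffunE; case: (_ p) => ? ?; case: (_ p).
Qed.

Lemma state_coordN i (U : V) : state_coord i (- U) = - state_coord i U.
Proof.
case: i => [[b c] p]; rewrite /state_coord /=.
by case: b; case: c; rewrite !ffunE; case: (_ p).
Qed.

Lemma state_coordB i (U W : V) :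
  state_coord i (U - W) = state_coord i U - state_coord i W.
Proof. by rewrite state_coordD state_coordN. Qed.

Lemma state_coordZ i (r : R) (U : V) :
  state_coord i (r%:C *: U) = r * state_coord i U.
Proof.
case: i => [[b c] p]; rewrite /state_coord /=.
by case: b; case: c; rewrite !ffunE; case: (_ p) => ? ? /=;
  rewrite ?(mul0r, addr0, subr0).
Qed.

Definition norm1 (U : V) : R := \sum_i `|state_coord i U|.

Lemma norm1_ge0 (U : V) : 0 <= norm1 U.
Proof. exact: sumr_ge0. Qed.

Lemma norm1D (U W : V) : norm1 (U + W) <= norm1 U + norm1 W.
Proof.
rewrite /norm1 -big_split; apply: ler_sum => i _.
by rewrite state_coordD ler_normD.
Qed.

Lemma norm1N (U : V) : norm1 (- U) = norm1 U.
Proof. by apply: eq_bigr => i _; rewrite state_coordN normrN. Qed.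

Lemma norm1Zr (r : R) (U : V) : norm1 (r%:C *: U) = `|r| * norm1 U.
Proof.
by rewrite /norm1 mulr_sumr; apply: eq_bigr => i _; rewrite state_coordZ normrM.
Qed.

(** The l^1 modulus is submultiplicative like the usual one, and is the contribution of one complex
    entry to [norm1]. *)
Definition cnorm1 (z : R[i]) : R := `|complex.Re z| + `|complex.Im z|.

Lemma cnorm1_ge0 z : 0 <= cnorm1 z.
Proof. exact: addr_ge0. Qed.

Lemma cnorm1D z w : cnorm1 (z + w) <= cnorm1 z + cnorm1 w.
Proof.
case: z w => [a b] [c d]; rewrite /cnorm1 /=.
by have := ler_normD a c; have := ler_normD b d; lra.
Qed.

Lemma cnorm1N z : cnorm1 (- z) = cnorm1 z.
Proof. by case: z => a b; rewrite /cnorm1 /= !normrN. Qed.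

Lemma cnorm1B z w : cnorm1 (z - w) <= cnorm1 z + cnorm1 w.
Proof. by rewrite -(cnorm1N w) cnorm1D. Qed.

Lemma cnorm1M z w : cnorm1 (z * w) <= cnorm1 z * cnorm1 w.
Proof.
case: z w => [a b] [c d]; rewrite /cnorm1 /=.
have := ler_normB (a * c) (b * d); have := ler_normD (a * d) (b * c).
rewrite !normrM mulrDl !mulrDr; lra.
Qed.

Lemma cnorm1_le_norm1 (U : V) (p : 'I_3 * cell A N) :
  cnorm1 (U.1 p) <= 2 * norm1 U /\ cnorm1 (U.2 p) <= 2 * norm1 U.
Proof.
have le i : `|state_coord i U| <= norm1 U.
  exact: (norm_le_sumr_norm (fun i => state_coord i U)).
have := (le (true, true, p), le (true, false, p), le (false, true, p),
  le (false, false, p)).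
rewrite /state_coord /= => -[[[h1 h2] h3] h4].
by split; rewrite mulr_natl mulr2n; apply: lerD.
Qed.

Lemma norm1_le_cnorm1 (U : V) (M : R) : 0 <= M ->
  (forall p, cnorm1 (U.1 p) <= M) -> (forall p, cnorm1 (U.2 p) <= M) ->
  norm1 U <= #|{: bool * bool * ('I_3 * cell A N)}|%:R * M.
Proof.
move=> M0 U1 U2; apply: sumr_norm_le_card => -[[b c] p].
have [h1 h2] : cnorm1 (U.1 p) <= M /\ cnorm1 (U.2 p) <= M by [].
apply: le_trans (_ : cnorm1 ((if b then U.1 else U.2) p) <= _); last by case: b.
by rewrite /state_coord /cnorm1 /=; case: c; rewrite ?lerDl ?lerDr.
Qed.

(** A nonreal scalar mixes real and imaginary coordinates, so the exact scaling of [norm1Zr] is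
    replaced by a bound obtained entrywise from [cnorm1M]. *)
Lemma norm1Z (z : R[i]) : exists2 K, 0 <= K &
  forall U : V, norm1 (z *: U) <= K * norm1 U.
Proof.
exists (#|{: bool * bool * ('I_3 * cell A N)}|%:R * (cnorm1 z * 2)).
  by rewrite !mulr_ge0 // cnorm1_ge0.
move=> U; rewrite -!mulrA; apply: norm1_le_cnorm1 => [|p|p].
- by rewrite !mulr_ge0 ?cnorm1_ge0 ?norm1_ge0.
- rewrite ffunE; apply: le_trans (cnorm1M _ _) _.
  by rewrite ler_wpM2l ?cnorm1_ge0 //; case: (cnorm1_le_norm1 U p).
- rewrite ffunE; apply: le_trans (cnorm1M _ _) _.
  by rewrite ler_wpM2l ?cnorm1_ge0 //; case: (cnorm1_le_norm1 U p).
Qed.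

Lemma curl_is_linear half : linear (@curl R A N dx half).
Proof.
move=> a u v.
have E q : (a *: u + v) q = a * u q + v q by rewrite !ffunE.
apply/ffunP => p; rewrite [RHS]ffunE [in RHS]ffunE !ffunE /=.
rewrite -[_ *: (_ - _)]/(a * _) /ddiff !E.
by do ?(case: ifP => _); ring.
Qed.

HB.instance Definition _ half :=
  GRing.isLinear.Build R[i] (vfield R A N) (vfield R A N) _ (@curl R A N dx half)
    (curl_is_linear half).

Lemma Ch_is_linear : linear (@Ch R A N dx nu).
Proof.
move=> a U W; apply: injective_projections; rewrite /Ch /= ?scaler0 ?addr0 //.
by rewrite linearP scalerDr !scalerA mulrC.
Qed.

Lemma Dh_is_linear : linear (@Dh R A N dx nu).
Proof.
move=> a U W; apply: injective_projections; rewrite /Dh /= ?scaler0 ?addr0 //.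
by rewrite linearP scalerDr opprD scalerN !scalerA mulrC.
Qed.

HB.instance Definition _ :=
  GRing.isLinear.Build R[i] V V _ (@Ch R A N dx nu) Ch_is_linear.
HB.instance Definition _ :=
  GRing.isLinear.Build R[i] V V _ (@Dh R A N dx nu) Dh_is_linear.

Local Notation C := (@Ch R A N dx nu).
Local Notation D := (@Dh R A N dx nu).

Definition generator (U : V) : V := C U + D U.

Lemma generator_is_linear : linear generator.
Proof.
move=> a U W; rewrite /generator (linearP C) (linearP D) scalerDr.
exact: addrACA.
Qed.

HB.instance Definition _ :=
  GRing.isLinear.Build R[i] V V _ generator generator_is_linear.

Lemma expCh_is_linear tau : linear (@expCh R A N dx nu tau).
Proof.
move=> a U W; rewrite /expCh linearP !scalerDr addrACA.
by rewrite !scalerA mulrC.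
Qed.

Lemma expDh_is_linear tau : linear (@expDh R A N dx nu tau).
Proof.
move=> a U W; rewrite /expDh linearP !scalerDr addrACA.
by rewrite !scalerA mulrC.
Qed.

HB.instance Definition _ tau :=
  GRing.isLinear.Build R[i] V V _ (@expCh R A N dx nu tau) (expCh_is_linear tau).
HB.instance Definition _ tau :=
  GRing.isLinear.Build R[i] V V _ (@expDh R A N dx nu tau) (expDh_is_linear tau).

Lemma PhiB a dt (U W : V) :
  Phi dx nu a dt (U - W) = Phi dx nu a dt U - Phi dx nu a dt W.
Proof. by rewrite /Phi !raddfB. Qed.

Lemma Phi_expansion a dt (U : V) :
  Phi dx nu a dt U = U + dt%:C *: generator U
    + (dt ^+ 2 / 2)%:C *: generator (generator U)
    + (dt ^+ 3)%:C *:
      ((a * (1 - 2 * a) + a ^+ 2) *: C (D (C U)) + ((1 - 2 * a) / 4) *: D (C (D U))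
       + dt%:C *: ((a * (1 - 2 * a) / 4) *: (C (D (C (D U))) + D (C (D (C U)))))
       + (dt ^+ 2)%:C *: ((a ^+ 2 * (1 - 2 * a) / 4) *: C (D (C (D (C U)))))).
Proof.
have -> : (dt ^+ 2 / 2)%:C = dt%:C ^+ 2 / 2.
  by rewrite rmorphM rmorphXn fmorphV rmorph_nat.
rewrite !rmorphXn /=.
(* The evaluations at single entries of [h] and [e] serve as separating functionals. *)
pose f (i : bool * ('I_3 * cell A N)) (W : V) := (if i.1 then W.1 else W.2) i.2.
apply: (@splitting_expansion _ _ _ f C D a dt%:C).
- by move=> [[] p] U1 U2; rewrite /f /= ffunE.
- by move=> [[] p] s W; rewrite /f /= ffunE.
- move=> U1 U2 fE; apply: injective_projections; apply/ffunP => p.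
  + exact: (fE (true, p)).
  + exact: (fE (false, p)).
- exact: Ch_nilp.
- exact: Dh_nilp.
Qed.

End StateSpace.

(** * Operator bounds, consistency and stability of the time step *)

Section Bounds.
Local Open Scope complex_scope.
Variables (R : realType) (A : {set 'I_3}) (N : 'I_3 -> nat) (dx nu : R).
Local Notation V := (state R A N).
Local Notation C := (@Ch R A N dx nu).
Local Notation D := (@Dh R A N dx nu).
Local Notation L := (@generator R A N dx nu).
Local Notation card_coord := (#|{: bool * bool * ('I_3 * cell A N)}|%:R : R).

(** Boundedness with an unspecified constant is closed under sums, composition and scaling, so every
    word in [Ch] and [Dh] inherits it from these two operators. *)
Definition norm1_bounded (F : V -> V) : Prop :=
  exists2 K : R, 0 <= K & forall U, norm1 (F U) <= K * norm1 U.

Lemma norm1_bounded_scale (z : R[i]) : norm1_bounded (fun U => z *: U).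
Proof. by have [K K0 KP] := @norm1Z R A N z; exists K. Qed.

Lemma norm1_boundedD F G : norm1_bounded F -> norm1_bounded G ->
  norm1_bounded (fun U => F U + G U).
Proof.
move=> [K K0 FK] [M M0 GM]; exists (K + M); first exact: addr_ge0.
by move=> U; rewrite mulrDl; apply: le_trans (norm1D _ _) (lerD (FK U) (GM U)).
Qed.

Lemma norm1_bounded_comp F G : norm1_bounded F -> norm1_bounded G ->
  norm1_bounded (fun U => F (G U)).
Proof.
move=> [K K0 FK] [M M0 GM]; exists (K * M); first exact: mulr_ge0.
by move=> U; rewrite -mulrA; apply: le_trans (FK _) (ler_wpM2l K0 (GM U)).
Qed.

Lemma norm1_boundedZ z F : norm1_bounded F -> norm1_bounded (fun U => z *: F U).
Proof. exact/norm1_bounded_comp/norm1_bounded_scale. Qed.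

Lemma cnorm1_ddiff half xi : exists2 K : R, 0 <= K &
  forall (u : cell A N -> R[i]) (M : R), (forall j, cnorm1 (u j) <= M) ->
    forall j, cnorm1 (ddiff dx half xi u j) <= K * M.
Proof.
set c := cnorm1 (27%:R : R[i]); set d := cnorm1 ((24%:R * dx%:C)^-1).
have c0 : 0 <= c by exact: cnorm1_ge0.
have d0 : 0 <= d by exact: cnorm1_ge0.
(* The stencil has two differences, each at most [2 * M], with weights 27 and 1, and a common factor
   of modulus [d]. *)
exists (((c + 1) * 2) * d); first by rewrite !mulr_ge0 ?addr_ge0.
move=> u M uM j; have M0 : 0 <= M := le_trans (cnorm1_ge0 _) (uM j).
have B k l : cnorm1 (u k - u l) <= 2 * M.
  by apply: le_trans (cnorm1B _ _) _; rewrite mulr_natl mulr2n lerD.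
have E k l m n : cnorm1 ((27%:R * (u k - u l) - (u m - u n)) / (24%:R * dx%:C))
    <= (c + 1) * 2 * d * M.
  apply: le_trans (cnorm1M _ _) _; rewrite -/d [leRHS]mulrAC ler_wpM2r //.
  apply: le_trans (cnorm1B _ _) _; rewrite -[leRHS]mulrA [leRHS]mulrDl mul1r.
  apply: lerD => //; apply: le_trans (cnorm1M _ _) _.
  by rewrite ler_wpM2l.
rewrite /ddiff; case: ifP => _; last first.
  by rewrite /cnorm1 /= normr0 addr0 !mulr_ge0 ?addr_ge0.
by case: ifP => _; exact: E.
Qed.

Lemma cnorm1_curl half : exists2 K : R, 0 <= K &
  forall (u : vfield R A N) (M : R), (forall p, cnorm1 (u p) <= M) ->
    forall p, cnorm1 (curl dx half u p) <= K * M.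
Proof.
pose K b xi : R := s2val (cid2 (cnorm1_ddiff b xi)).
have K0 b xi : 0 <= K b xi by exact: s2valP (cid2 (cnorm1_ddiff b xi)).
have KP b xi (u : cell A N -> R[i]) (M : R) : (forall j, cnorm1 (u j) <= M) ->
    forall j, cnorm1 (ddiff dx b xi u j) <= K b xi * M.
  exact: s2valP' (cid2 (cnorm1_ddiff b xi)) u M.
(* The sum over both staggerings and all directions dominates every stencil constant, giving one
   bound for all components of the curl. *)
pose S := \sum_(q : bool * 'I_3) K q.1 q.2.
have KS b xi : K b xi <= S.
  by rewrite /S (bigD1 (b, xi)) //= lerDl sumr_ge0.
have S0 : 0 <= S by exact: sumr_ge0.
exists (S + S); first exact: addr_ge0.
move=> u M uM p; have M0 : 0 <= M := le_trans (cnorm1_ge0 _) (uM p).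
rewrite /curl ffunE mulrDl; apply: le_trans (cnorm1B _ _) _.
by apply: lerD; (apply: le_trans (KP _ _ _ M _ _) _; [by move=> j|exact: ler_wpM2r]).
Qed.

Lemma norm1_bounded_Ch : norm1_bounded C.
Proof.
have [K K0 KP] := cnorm1_curl h_half.
exists (card_coord * (cnorm1 nu%:C * (K * 2))).
  by rewrite !mulr_ge0 ?cnorm1_ge0.
move=> U; rewrite -!mulrA; apply: norm1_le_cnorm1 => [|p|p].
- by rewrite !mulr_ge0 ?cnorm1_ge0 ?norm1_ge0.
- rewrite ffunE /cnorm1 /= normr0 addr0.
  by rewrite !mulr_ge0 ?cnorm1_ge0 ?norm1_ge0.
- rewrite ffunE; apply: le_trans (cnorm1M _ _) _; rewrite ler_wpM2l ?cnorm1_ge0 //.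
  by apply: KP => q; case: (cnorm1_le_norm1 U q).
Qed.

Lemma norm1_bounded_Dh : norm1_bounded D.
Proof.
have [K K0 KP] := cnorm1_curl e_half.
exists (card_coord * (cnorm1 nu%:C * (K * 2))).
  by rewrite !mulr_ge0 ?cnorm1_ge0.
move=> U; rewrite -!mulrA; apply: norm1_le_cnorm1 => [|p|p].
- by rewrite !mulr_ge0 ?cnorm1_ge0 ?norm1_ge0.
- rewrite !ffunE cnorm1N.
  apply: le_trans (cnorm1M _ _) _; rewrite ler_wpM2l ?cnorm1_ge0 //.
  have := KP U.2 (2 * norm1 U) _ p; rewrite [curl _ _ _ _]ffunE; apply => q.
  by case: (cnorm1_le_norm1 U q).
- rewrite ffunE /cnorm1 /= normr0 addr0.
  by rewrite !mulr_ge0 ?cnorm1_ge0 ?norm1_ge0.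
Qed.

Lemma norm1_bounded_generator : norm1_bounded L.
Proof. exact: norm1_boundedD norm1_bounded_Ch norm1_bounded_Dh. Qed.

(** By [Phi_expansion] the difference is [dt ^+ 3] times words of length three, four and five with
    coefficients of order 1, [dt] and [dt ^+ 2]; the last two powers are bounded by [T] and
    [T ^+ 2]. *)
Lemma norm1_Phi_consistency (a : R[i]) (T : R) : 0 <= T ->
  exists2 K : R, 0 <= K & forall (dt : R) (U : V), 0 <= dt <= T ->
    norm1 (Phi dx nu a dt U
           - (U + dt%:C *: L U + (dt ^+ 2 / 2)%:C *: L (L U)))
    <= K * dt ^+ 3 * norm1 U.
Proof.
move=> T0; have [bC bD] := (norm1_bounded_Ch, norm1_bounded_Dh).
have bDC := norm1_bounded_comp bD bC; have bCD := norm1_bounded_comp bC bD.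
have bCDC := norm1_bounded_comp bC bDC.
have bCDCD := norm1_bounded_comp bCD bCD; have bDCDC := norm1_bounded_comp bDC bDC.
have [K3 K30 P3] := norm1_boundedD (norm1_boundedZ (a * (1 - 2 * a) + a ^+ 2) bCDC)
  (norm1_boundedZ ((1 - 2 * a) / 4) (norm1_bounded_comp bD bCD)).
have [K4 K40 P4] := norm1_boundedZ (a * (1 - 2 * a) / 4) (norm1_boundedD bCDCD bDCDC).
have [K5 K50 P5] := norm1_boundedZ (a ^+ 2 * (1 - 2 * a) / 4)
  (norm1_bounded_comp bCD bCDC).
exists (K3 + T * K4 + T ^+ 2 * K5); first by rewrite !addr_ge0 ?mulr_ge0 ?exprn_ge0.
move=> dt U /andP[dt0 dtT].
rewrite Phi_expansion addrC addKr norm1Zr ger0_norm ?exprn_ge0 //.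
rewrite [leRHS]mulrAC [leRHS]mulrC ler_wpM2l ?exprn_ge0 //.
rewrite (mulrDl _ _ (norm1 U)) (mulrDl K3).
apply: le_trans (norm1D _ _) (lerD (le_trans (norm1D _ _) (lerD (P3 U) _)) _).
- rewrite norm1Zr ger0_norm // -[leRHS]mulrA.
  by apply: ler_pM => //; exact: norm1_ge0.
- rewrite norm1Zr ger0_norm ?exprn_ge0 // -[leRHS]mulrA.
  apply: ler_pM; [exact: exprn_ge0|exact: norm1_ge0| |exact: P5].
  by rewrite ler_pXn2r ?nnegrE.
Qed.

(** This rests on [1 + x <= expR x]. In exponential form the exponents of successive substeps and
    time steps simply add up. *)
Lemma norm1_substep (F : V -> V) (z : R[i]) : norm1_bounded F ->
  exists2 K : R, 0 <= K & forall (dt : R) (U : V), 0 <= dt ->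
    norm1 (U + (z * dt%:C) *: F U) <= expR (K * dt) * norm1 U.
Proof.
move=> /(norm1_boundedZ z)[K K0 FK]; exists K => // dt U dt0.
apply: (@le_trans _ _ ((1 + K * dt) * norm1 U)); last first.
  by rewrite ler_wpM2r ?norm1_ge0 ?expR_ge1Dx.
apply: le_trans (norm1D _ _) _; rewrite mulrDl mul1r lerD2l mulrC -scalerA.
by rewrite norm1Zr ger0_norm // (mulrC K) -mulrA ler_wpM2l.
Qed.

Lemma norm1_Phi_stability (a : R[i]) :
  exists2 K : R, 0 <= K & forall (dt : R) (U : V), 0 <= dt ->
    norm1 (Phi dx nu a dt U) <= expR (K * dt) * norm1 U.
Proof.
have [bC bD] := (norm1_bounded_Ch, norm1_bounded_Dh).
have [K1 K10 P1] := norm1_substep a bC.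
have [K2 K20 P2] := norm1_substep (2%:R^-1) bD.
have [K3 K30 P3] := norm1_substep (1 - 2%:R * a) bC.
exists (K1 + (K2 + (K3 + (K2 + K1)))); first by rewrite !addr_ge0.
move=> dt U dt0.
have leC1 (W : V) : norm1 (expCh dx nu (a * dt%:C) W) <= expR (K1 * dt) * norm1 W.
  exact: (P1 dt W dt0).
have leD (W : V) : norm1 (expDh dx nu (2%:R^-1 * dt%:C) W) <= expR (K2 * dt) * norm1 W.
  exact: (P2 dt W dt0).
have leC2 (W : V) : norm1 (expCh dx nu ((1 - 2%:R * a) * dt%:C) W)
    <= expR (K3 * dt) * norm1 W by exact: (P3 dt W dt0).
rewrite !mulrDl !expRD -!mulrA /Phi.
apply: le_trans (leC1 _) _; apply: (ler_wpM2l (expR_ge0 _)).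
apply: le_trans (leD _) _; apply: (ler_wpM2l (expR_ge0 _)).
apply: le_trans (leC2 _) _; apply: (ler_wpM2l (expR_ge0 _)).
by apply: le_trans (leD _) _; apply: (ler_wpM2l (expR_ge0 _)).
Qed.

End Bounds.

(** * Growth and Taylor expansion of the semidiscrete solution *)

Section Evolution.
Local Open Scope complex_scope.
Variables (R : realType) (A : {set 'I_3}) (N : 'I_3 -> nat) (dx nu : R).
Local Notation V := (state R A N).
Local Notation L := (@generator R A N dx nu).
Local Notation card_coord := (#|{: bool * bool * ('I_3 * cell A N)}|%:R : R).

Section Solution.
Variables (U : R -> V) (solU : semidiscrete_solution dx nu U).

Lemma state_coord_solution_derive i (t : R) : 0 < t ->
  is_derive t 1 (fun s => state_coord i (U s)) (state_coord i (L (U t))).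
Proof.
case: solU => _ _ dU /dU[dU1 dU2]; case: i => [[b c] p].
by rewrite /state_coord; case: b; case: c;
  [have [] := dU1 p | have [] := dU1 p | have [] := dU2 p | have [] := dU2 p].
Qed.

Lemma state_coord_solution_cvg i :
  (state_coord i (U s) @[s --> 0^'+] --> state_coord i (U 0))%classic.
Proof.
case: solU => cU1 cU2 _; case: i => [[b c] p].
by rewrite /state_coord; case: b; case: c;
  [have [] := cU1 p | have [] := cU1 p | have [] := cU2 p | have [] := cU2 p].
Qed.

(** Gronwall controls the l^2 norm of the coordinates. Passing from l^1 to l^2 at time [t] costs the
    factor [card_coord]; passing back at time 0 has constant 1. *)
Lemma norm1_solution_le (k : R) : 0 <= k ->
  (forall W, norm1 (L W) <= k * norm1 W) ->
  forall t, 0 <= t ->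
    norm1 (U t) <=
      card_coord * Num.sqrt (expR (2 * k * card_coord ^+ 2 * t)) * norm1 (U 0).
Proof.
move=> k0 kL t t0.
apply: le_trans (sumr_norm_le_sqrt (fun i => state_coord i (U t))) _.
rewrite -mulrA ler_wpM2l //.
have := @gronwall_sumr_sqr _ _ (fun i s => state_coord i (U s))
  (fun i s => state_coord i (L (U s))) k k0 state_coord_solution_cvg
  state_coord_solution_derive (fun s _ => kL (U s)) t t0.
rewrite -ler_sqrt ?mulr_ge0 ?expR_ge0 ?sumr_ge0 // => [|i _]; last exact: sqr_ge0.
rewrite sqrtrM ?expR_ge0 // => h; apply: le_trans h _.
rewrite ler_wpM2l ?sqrtr_ge0 // -(ger0_norm (norm1_ge0 (U 0))) -sqrtr_sqr.
by rewrite ler_sqrt ?sqr_ge0 // sumr_sqr_le.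
Qed.

(** Since [U' = L U], the hypothesis bounds the derivative of [U] minus a quadratic polynomial, and
    the mean value theorem integrates it. Each use turns an approximation of [L U] into one of [U]
    that is one order better. *)
Lemma norm1_solution_taylor_step (t s M : R) (X Y : V) : 0 <= t -> t < s ->
  (forall r, t < r < s -> norm1 (L (U r) - X - (r - t)%:C *: Y) <= M) ->
  norm1 (U s - U t - (s - t)%:C *: X - ((s - t) ^+ 2 / 2)%:C *: Y)
    <= card_coord * M * (s - t).
Proof.
move=> t0 ts LM.
pose f i (r : R) := state_coord i (U r) - (r - t) * state_coord i X
  - (r - t) ^+ 2 / 2 * state_coord i Y.
pose g i (r : R) := state_coord i (L (U r) - X - (r - t)%:C *: Y).
have dp (i : bool * bool * ('I_3 * cell A N)) (r : R) :
    is_derive r 1 (fun r : R => (r - t) * state_coord i X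
        + (r - t) ^+ 2 / 2 * state_coord i Y)
      (state_coord i X + (r - t) * state_coord i Y).
  have d1 : is_derive r 1 (fun r : R => r - t) 1.
    have := is_deriveB (is_derive_id r (1 : R)) (is_derive_cst t r (1 : R)).
    by rewrite subr0.
  have d2 : is_derive r 1 (fun r : R => (r - t) ^+ 2) (2 * (r - t)).
    have := is_deriveX 2 d1.
    by rewrite /= expr1 -[_ *: 1]/(_ * 1) mulr1.
  have := is_deriveD (is_deriveZ (state_coord i X) d1) (is_deriveZ (state_coord i Y / 2) d2).
  rewrite -![_ *: _]/(_ * _) mulr1 mulrA divfK ?pnatr_eq0 // [_ * (r - t)]mulrC.
  rewrite [X in is_derive _ _ X _](_ : _ = (fun r : R => (r - t) * state_coord i X
    + (r - t) ^+ 2 / 2 * state_coord i Y)) //.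
  apply/funext => u.
  rewrite -[LHS]/(state_coord i X * (u - t) + state_coord i Y / 2 * (u - t) ^+ 2).
  by ring.
have df i (r : R) : 0 < r -> is_derive r 1 (f i) (g i r).
  move=> r0; have := is_deriveB (state_coord_solution_derive i r0) (dp i r).
  rewrite [X in is_derive _ _ X _](_ : _ = f i); last first.
    by apply/funext => u; rewrite /f /= opprD addrA.
  by rewrite /g !state_coordB state_coordZ opprD addrA.
have cf i : {within `[t, s], continuous (f i)}%classic.
  apply: (continuous_within_half_line t0 ts) => [|r r0]; last by case: (df i r r0).
  have cp : {for 0, continuous (fun r : R => (r - t) * state_coord i X
      + (r - t) ^+ 2 / 2 * state_coord i Y)}%classic.
    by apply/differentiable_continuous/derivable1_diffP; case: (dp i 0).
  rewrite (_ : f i = fun r => state_coord i (U r) - ((r - t) * state_coord i X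
      + (r - t) ^+ 2 / 2 * state_coord i Y)); last first.
    by apply/funext => u; rewrite /f opprD addrA.
  by apply: cvgB; [exact: state_coord_solution_cvg|exact: cvg_at_right_filter].
have dfi i (r : R) : t < r < s -> is_derive r 1 (f i) (g i r).
  by case/andP => tr _; apply: df; exact: le_lt_trans tr.
have := sumr_mean_value ts cf dfi LM.
apply: le_trans; rewrite le_eqVlt; apply/orP; left; apply/eqP.
apply: eq_bigr => i _; congr (`|_|).
rewrite /f !state_coordB !state_coordZ subrr expr0n /= !mul0r !subr0.
ring.
Qed.

Lemma norm1_solution_taylor (k M t s : R) : 0 <= k ->
  (forall W, norm1 (L W) <= k * norm1 W) -> 0 <= t -> t < s ->
  (forall r, t <= r <= s -> norm1 (U r) <= M) ->
  norm1 (U s - (U t + (s - t)%:C *: L (U t)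
                + ((s - t) ^+ 2 / 2)%:C *: L (L (U t))))
    <= (card_coord * k * (s - t)) ^+ 3 * M.
Proof.
move=> k0 kL t0 ts UM; set n := card_coord.
have M0 : 0 <= M by apply: le_trans (norm1_ge0 (U t)) (UM _ _); rewrite lexx ltW.
have st0 : 0 <= s - t by rewrite subr_ge0 ltW.
have n0 : 0 <= n by [].
have LB X Y : L (X - Y) = L X - L Y by exact: raddfB.
have LZ z X : L (z *: X) = z *: L X by exact: linearZ_LR.
have in_sub r : t < r < s -> forall u, t <= u <= r -> norm1 (U u) <= M.
  by case/andP=> _ rs u /andP[tu ur]; rewrite UM // tu (le_trans ur (ltW rs)).
(* The bootstrap starts with [X = Y = 0] and the bound [k * M] on [L U]. Each round applies [L] to
   the previous remainder (factor [k]) and integrates (factor [n * (r - t)]). *)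
have step1 r : t < r < s -> norm1 (U r - U t) <= n * k * (r - t) * M.
  move=> trs; have /andP[tr rs] := trs.
  have := @norm1_solution_taylor_step t r (k * M) 0 0 t0 tr.
  rewrite !scaler0 !subr0 => h; apply: le_trans (h _) _; last first.
    by rewrite le_eqVlt; apply/orP; left; apply/eqP; ring.
  move=> u /andP[tu ur]; rewrite scaler0 !subr0; apply: le_trans (kL _) _.
  by rewrite ler_wpM2l // (in_sub r) // !ltW.
(* Second round, with [X = L (U t)] and [Y = 0]. *)
have step2 r : t < r < s ->
    norm1 (U r - U t - (r - t)%:C *: L (U t)) <= (n * k * (r - t)) ^+ 2 * M.
  move=> trs; have /andP[tr rs] := trs.
  have := @norm1_solution_taylor_step t r (k * (n * k * (r - t) * M)) (L (U t)) 0 t0 tr.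
  rewrite scaler0 subr0 => h; apply: le_trans (h _) _; last first.
    by rewrite le_eqVlt; apply/orP; left; apply/eqP; ring.
  move=> u /andP[tu ur]; rewrite scaler0 subr0 -LB; apply: le_trans (kL _) _.
  rewrite ler_wpM2l //; apply: le_trans (step1 u _) _.
    by rewrite tu (lt_trans ur).
  by rewrite ler_wpM2r // ler_wpM2l ?mulr_ge0 // lerD2r ltW.
rewrite !opprD !addrA.
(* Third round, with [X = L (U t)] and [Y = L (L (U t))]. *)
have h := @norm1_solution_taylor_step t s (k * ((n * k * (s - t)) ^+ 2 * M))
  (L (U t)) (L (L (U t))) t0 ts.
apply: le_trans (h _) _; last first.
  by rewrite le_eqVlt; apply/orP; left; apply/eqP; rewrite -/n; ring.
move=> u tus; have /andP[tu us] := tus.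
have -> : L (U u) - L (U t) - (u - t)%:C *: L (L (U t))
    = L (U u - U t - (u - t)%:C *: L (U t)) by rewrite !LB LZ.
apply: le_trans (kL _) _; rewrite ler_wpM2l //; apply: le_trans (step2 u tus) _.
rewrite ler_wpM2r // ler_pXn2r ?nnegrE ?mulr_ge0 // ?subr_ge0 ?(ltW tu) //.
by rewrite ler_wpM2l ?mulr_ge0 // lerD2r ltW.
Qed.

End Solution.
End Evolution.

(** * Equivalence of the discrete l^2 norm and the l^1 norm *)

Section Norm.
Variables (R : realType) (A : {set 'I_3}) (N : 'I_3 -> nat) (dx : R).
Local Notation V := (state R A N).

Lemma norm_h_state_coord (U : V) :
  norm_h dx U = Num.sqrt (dx ^+ #|A| * \sum_i state_coord i U ^+ 2).
Proof.
rewrite /norm_h; congr (Num.sqrt (_ * _)).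
rewrite -(pair_bigA _ (fun bc p => state_coord (bc, p) U ^+ 2)) /=.
rewrite -(pair_bigA _ (fun b c => \sum_p state_coord ((b, c), p) U ^+ 2)) /=.
rewrite !big_bool /=.
by congr (_ + _); rewrite -big_split /=; apply: eq_bigr => p _; rewrite /state_coord /=;
  case: (_ p) => a b /=; rewrite sqr_sqrtr // addr_ge0 ?sqr_ge0.
Qed.

Lemma norm_h_le_norm1 (U : V) : 0 < dx ->
  norm_h dx U <= Num.sqrt (dx ^+ #|A|) * norm1 U.
Proof.
move=> dx0; rewrite norm_h_state_coord sqrtrM ?exprn_ge0 ?(ltW dx0) //.
rewrite ler_wpM2l ?sqrtr_ge0 // -(ger0_norm (norm1_ge0 U)) -sqrtr_sqr.
by rewrite ler_sqrt ?sqr_ge0 // sumr_sqr_le.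
Qed.

Lemma norm1_le_norm_h (U : V) : 0 < dx ->
  norm1 U <= #|{: bool * bool * ('I_3 * cell A N)}|%:R
    / Num.sqrt (dx ^+ #|A|) * norm_h dx U.
Proof.
move=> dx0; rewrite norm_h_state_coord sqrtrM ?exprn_ge0 ?(ltW dx0) //.
rewrite mulrA divfK; last by rewrite gt_eqF // sqrtr_gt0 exprn_gt0.
exact: (sumr_norm_le_sqrt (fun i => state_coord i U)).
Qed.

End Norm.

(** * Accumulation of the local errors and convergence *)

Lemma norm1_global_error (R : realType) (A : {set 'I_3}) (N : 'I_3 -> nat)
    (dx nu : R) (a : R[i]%C) (T : R) : 0 < T ->
  exists2 K : R, 0 <= K & forall dt : R, 0 < dt ->
    forall U : R -> state R A N, semidiscrete_solution dx nu U ->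
    forall n : nat, n%:R * dt <= T ->
      norm1 (iter n (Phi dx nu a dt) (U 0) - U (n%:R * dt))
      <= K * dt ^+ 2 * norm1 (U 0).
Proof.
move=> T0; set c : R := #|{: bool * bool * ('I_3 * cell A N)}|%:R.
have [k k0 kL] := @norm1_bounded_generator R A N dx nu.
have [Kc Kc0 Pc] := @norm1_Phi_consistency R A N dx nu a T (ltW T0).
have [l l0 Pl] := @norm1_Phi_stability R A N dx nu a.
(* [B] is the growth factor of the exact solution over [[0, T]]. *)
have [B BE] : exists B, B = c * Num.sqrt (expR (2 * k * c ^+ 2 * T)) by eexists.
have B0 : 0 <= B by rewrite BE mulr_ge0 ?sqrtr_ge0.
(* [K] adds the consistency constant of [Phi] and the Taylor constant of the solution; both local
   errors are relative to the current solution, of size at most [B * M]. *)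
have [K KE] : exists K, K = (Kc + (c * k) ^+ 3) * B by eexists.
have K0 : 0 <= K by rewrite KE mulr_ge0 // addr_ge0 // exprn_ge0 // mulr_ge0.
exists (T * K * expR (l * T)); first by rewrite !mulr_ge0 ?expR_ge0 // ltW.
move=> dt dt0 U solU; set M := norm1 (U 0); have M0 : 0 <= M by exact: norm1_ge0.
have UB r : 0 <= r <= T -> norm1 (U r) <= B * M.
  case/andP=> r0 rT; apply: le_trans (norm1_solution_le solU k0 kL r0) _.
  rewrite BE ler_wpM2r // ler_wpM2l // ler_sqrt ?expR_ge0 // ler_expR.
  by rewrite ler_wpM2l // !mulr_ge0 // exprn_ge0.
have rec n : n%:R * dt <= T ->
    norm1 (iter n (Phi dx nu a dt) (U 0) - U (n%:R * dt))
    <= n%:R * (K * dt ^+ 3 * M) * expR (l * (n%:R * dt)).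
  elim: n => [_|n IH nT].
    rewrite /= !mul0r subrr /norm1 big1 // => i _.
    by rewrite -(subrr (0 : state R A N)) state_coordB subrr normr0.
  set t := n%:R * dt; have t0 : 0 <= t by rewrite mulr_ge0 // ltW.
  have tE : n.+1%:R * dt = t + dt by rewrite -natr1 mulrDl mul1r.
  have tT : t + dt <= T by rewrite -tE.
  have tT' : t <= T by apply: le_trans tT; rewrite lerDl ltW.
  have dtT : 0 <= dt <= T by rewrite ltW //= (le_trans _ tT) // lerDr.
  have tdt : t < t + dt by rewrite ltrDl.
  rewrite tE iterS; move: (iter n _ _) (IH tT') => X {}IH.
  pose Y := U t + dt%:C%C *: generator dx nu (U t)
    + (dt ^+ 2 / 2)%:C%C *: generator dx nu (generator dx nu (U t)).
  (* The new error is the old one propagated by [Phi], plus the deviations of the numerical and the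
     exact step from their common Taylor polynomial [Y]. *)
  have split_error : Phi dx nu a dt X - U (t + dt)
      = Phi dx nu a dt (X - U t) + (Phi dx nu a dt (U t) - Y) - (U (t + dt) - Y).
    have telescope (W : zmodType) (p q u y : W) :
        p - u = (p - q) + (q - y) - (u - y).
      by rewrite addrA subrK opprB addrA subrK.
    by rewrite PhiB; exact: telescope.
  rewrite split_error.
  apply: le_trans (norm1D _ _) _; rewrite norm1N.
  have e1 : norm1 (Phi dx nu a dt (X - U t))
      <= n%:R * (K * dt ^+ 3 * M) * expR (l * (t + dt)).
    apply: le_trans (Pl dt _ (ltW dt0)) _.
    by rewrite (mulrDr l) expRD [leRHS]mulrA [leRHS]mulrC ler_wpM2l ?expR_ge0.
  have e2 : norm1 (Phi dx nu a dt (U t) - Y) <= Kc * dt ^+ 3 * (B * M).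
    apply: le_trans (Pc dt (U t) dtT) _.
    by rewrite ler_wpM2l ?UB ?t0 // mulr_ge0 // exprn_ge0 // ltW.
  have e3 : norm1 (U (t + dt) - Y) <= (c * k * dt) ^+ 3 * (B * M).
    have := @norm1_solution_taylor _ _ _ _ _ U solU k (B * M) t (t + dt) k0 kL t0 tdt.
    rewrite (addrC t dt) addrK; apply => r /andP[tr rt].
    by rewrite UB // (le_trans t0 tr) (le_trans rt) // addrC.
  have e0 : 1 <= expR (l * (t + dt)).
    by rewrite -expR0 ler_expR mulr_ge0 // addr_ge0 // ltW.
  (* The fresh local error is enlarged by an exponential at least 1, so that it merges with the
     propagated term as the summand number [n + 1]. *)
  have e4 : K * dt ^+ 3 * M <= K * dt ^+ 3 * M * expR (l * (t + dt)).
    by apply: ler_peMr e0; rewrite mulr_ge0 // mulr_ge0 // exprn_ge0 // ltW.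
  have KMdt : Kc * dt ^+ 3 * (B * M) + (c * k * dt) ^+ 3 * (B * M)
      = K * dt ^+ 3 * M by rewrite KE; ring.
  rewrite -natr1 (mulrDl _ 1) mul1r (mulrDl _ _ (expR _)) -/t.
  apply: le_trans (lerD (norm1D _ _) (lexx _)) _; rewrite -addrA.
  apply: (lerD e1); apply: le_trans e4; rewrite -KMdt; exact: lerD.
move=> n nT; apply: le_trans (rec n nT) _.
(* One factor [dt] joins the number of steps, and [n * dt <= T] leaves [dt ^+ 2]. *)
have -> : n%:R * (K * dt ^+ 3 * M) * expR (l * (n%:R * dt))
    = (n%:R * dt) * (K * dt ^+ 2 * M) * expR (l * (n%:R * dt)) by ring.
have -> : T * K * expR (l * T) * dt ^+ 2 * M
    = T * (K * dt ^+ 2 * M) * expR (l * T) by ring.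
have KM : 0 <= K * dt ^+ 2 * M by rewrite mulr_ge0 // mulr_ge0 // exprn_ge0 // ltW.
have n0 : 0 <= n%:R * dt by rewrite mulr_ge0 // ltW.
apply: ler_pM => //.
- by rewrite mulr_ge0.
- exact: ler_wpM2r.
- by rewrite ler_expR ler_wpM2l.
Qed.

Theorem proposition3p5 (R : realType) (eps mu : R)
    (A : {set 'I_3}) (N : 'I_3 -> nat) (dx : R)
    (meth : splitting) (q0 T : R) :
  0 < eps -> 0 < mu ->
  (0 < #|A|)%N -> (forall xi, xi \in A -> (0 < N xi)%N) -> 0 < dx ->
  q0 < q_star R meth -> 0 < T ->
  let nu := (Num.sqrt (eps * mu))^-1 in
  exists C : R, forall dt : R, 0 < dt ->
    @modes_bounded R A N dx nu dt q0 ->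
    forall U : R -> state R A N, semidiscrete_solution dx nu U ->
    forall n : nat, n%:R * dt <= T ->
      norm_h dx (iter n (Phi dx nu (splitting_coef R meth) dt) (U 0)
                 - U (n%:R * dt))
      <= C * dt ^+ 2 * norm_h dx (U 0).
Proof.
move=> _ _ _ _ dx0 _ T0 nu.
have [K K0 KP] :=
  @norm1_global_error R A N dx nu (splitting_coef R meth) T T0.
set s := Num.sqrt (dx ^+ #|A|).
set c : R := #|{: bool * bool * ('I_3 * cell A N)}|%:R.
have s0 : 0 <= s by exact: sqrtr_ge0.
(* The factor [s] converts the error from [norm1] to [norm_h]; [c / s] converts the initial state
   from [norm_h] to [norm1]. *)
exists (s * K * (c / s)) => dt dt0 _ U solU n nT.
apply: le_trans (norm_h_le_norm1 _ dx0) _; rewrite -/s.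
apply: le_trans (ler_wpM2l s0 (KP dt dt0 U solU n nT)) _.
have -> : s * K * (c / s) * dt ^+ 2 * norm_h dx (U 0)
    = s * (K * dt ^+ 2 * (c / s * norm_h dx (U 0))) by ring.
rewrite ler_wpM2l // ler_wpM2l ?norm1_le_norm_h //.
by rewrite mulr_ge0 // exprn_ge0 // ltW.
Qed.
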